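(* Let $\langle A,R\rangle$ and $\langle B,S\rangle$ be objects of $\mathsf{EndoRel}$. Let $B^A$ be the set of all functions from $A$ to $B$, and define the relation $W$ on $B^A$ by: $\langle\alpha,\beta\rangle\in W$ iff for all $a,a'\in A$, $\langle a,a'\rangle\in R$ implies $\langle\alpha(a),\beta(a')\rangle\in S$. Let $eval:B^A\times A\to B$ be given by $eval(\alpha,a)=\alpha(a)$. Then $\langle B^A,W\rangle$ together with $eval$ is an exponential of $\langle B,S\rangle$ by $\langle A,R\rangle$ in $\mathsf{EndoRel}$. That is, $eval:\langle B^A,W\rangle\times\langle A,R\rangle\to\langle B,S\rangle$ is a morphism, and for every morphism $f:\langle X,V\rangle\times\langle A,R\rangle\to\langle B,S\rangle$ there is a unique morphism $\tilde f:\langle X,V\rangle\to\langle B^A,W\rangle$ such that $eval\circ(\tilde f\times 1_A)=f$, namely the one given by $\tilde f(x)(a)=f(x,a)$ for all $x\in X$ and $a\in A$.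
   Context: $\mathsf{EndoRel}$ is the category whose objects are pairs $\langle A,R\rangle$ with $A$ a set and $R\subseteq A\times A$ an arbitrary binary relation on $A$, and whose morphisms $f:\langle A,R\rangle\to\langle B,S\rangle$ are the functions $f:A\to B$ such that $\langle a,a'\rangle\in R$ implies $\langle f(a),f(a')\rangle\in S$ for all $a,a'\in A$. The product $\langle X,V\rangle\times\langle A,R\rangle$ is $\langle X\times A,V\times R\rangle$, where $V\times R$ relates $\langle x,a\rangle$ to $\langle x',a'\rangle$ iff $x\,V\,x'$ and $a\,R\,a'$. *)

(* Defs.v *)
From Stdlib Require Import Relation_Definitions.

Set Implicit Arguments.
Unset Strict Implicit.

Record EndoRel := MkEndoRel {
  carrier :> Type;
  rel : relation carrier
}.

Arguments rel : clear implicits.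

Definition is_morphism (X Y : EndoRel) (f : X -> Y) : Prop :=
  forall x x' : X, rel X x x' -> rel Y (f x) (f x').

Arguments is_morphism : clear implicits.

Definition prod_obj (X Y : EndoRel) : EndoRel :=
  @MkEndoRel (X * Y)
    (fun p q => rel X (fst p) (fst q) /\ rel Y (snd p) (snd q)).

Definition prod_map (X X' Y Y' : Type) (g : X -> X') (h : Y -> Y') :
    X * Y -> X' * Y' :=
  fun p => (g (fst p), h (snd p)).

(* The object [E] with [ev] is an exponential of [B] by [A]. Morphisms are
   functions satisfying [is_morphism], so equality of morphisms is equality
   of functions. *)
Definition is_exponential (B A E : EndoRel) (ev : prod_obj E A -> B) : Prop :=
  is_morphism (prod_obj E A) B ev /\
  forall (X : EndoRel) (f : prod_obj X A -> B),
    is_morphism (prod_obj X A) B f ->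
    exists! ft : X -> E,
      is_morphism X E ft /\
      (fun p : X * A => ev (prod_map ft (fun a : A => a) p)) = f.

Arguments is_exponential : clear implicits.

(* The carrier consists of all functions from [A] to [B], not only the
   morphisms. *)
Definition exp_obj (B A : EndoRel) : EndoRel :=
  @MkEndoRel (A -> B)
    (fun alpha beta =>
       forall a a' : A, rel A a a' -> rel B (alpha a) (beta a')).

Definition eval (B A : EndoRel) : prod_obj (exp_obj B A) A -> B :=
  fun p => (fst p) (snd p).

Arguments eval : clear implicits.

(* Main.v *)
Require Import Defs.
From Stdlib Require Import FunctionalExtensionality.

(** Currying is already a bijection on plain functions, so only preservation of relations is at
    stake. The relation on [exp_obj] compares values at two related arguments, which is just what
    [eval] needs. Unfolded, preservation by the curried map and preservation by [f] are the same
    implication. [transpose_iff] packages this. *)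

Lemma eval_is_morphism (A B : EndoRel) :
  is_morphism (prod_obj (exp_obj B A) A) B (eval B A).
Proof. intros [alpha a] [beta a'] [HW HR]; exact (HW a a' HR). Qed.

(** Evaluating the factorization at a pair forces every value of [ft]; this one equivalence
    therefore yields existence, uniqueness and the explicit formula. *)
Lemma transpose_iff (A B X : EndoRel) (f : prod_obj X A -> B) :
  is_morphism (prod_obj X A) B f ->
  forall ft : X -> exp_obj B A,
    (is_morphism X (exp_obj B A) ft /\
     (fun p : X * A => eval B A (prod_map ft (fun a : A => a) p)) = f)
    <-> (forall (x : X) (a : A), ft x a = f (x, a)).
Proof.
intros Hf ft; split.
- intros [_ <-] x a; reflexivity.
- intros Hft; split.
  + intros x x' HV a a' HR; rewrite !Hft.
    exact (Hf (x, a) (x', a') (conj HV HR)).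
  + apply functional_extensionality; intros [x a]; exact (Hft x a).
Qed.

Theorem mainTheorem7 (A B : EndoRel) :
  is_exponential B A (exp_obj B A) (eval B A) /\
  (forall (X : EndoRel) (f : prod_obj X A -> B),
     is_morphism (prod_obj X A) B f ->
     forall ft : X -> exp_obj B A,
       (is_morphism X (exp_obj B A) ft /\
        (fun p : X * A => eval B A (prod_map ft (fun a : A => a) p)) = f)
       <-> (forall (x : X) (a : A), ft x a = f (x, a))).
Proof.
split; [split |].
- apply eval_is_morphism.
- intros X f Hf; exists (fun x a => f (x, a)); split.
  (* Used from right to left: the curried [f] satisfies the pointwise formula by computation. *)
  + apply (transpose_iff A B X f Hf); reflexivity.
  + intros g Hg.
    apply functional_extensionality; intros x.
    apply functional_extensionality; intros a.
    symmetry; exact (proj1 (transpose_iff A B X f Hf g) Hg x a).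
- exact (transpose_iff A B).
Qed.
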